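(* Let $T>0$ and let $(u^\varepsilon,F^\varepsilon)_{\varepsilon>0}$ be a sequence of solutions of $$\partial_tu^\varepsilon+u^\varepsilon\cdot\nabla u^\varepsilon-\Delta u^\varepsilon+\nabla P^\varepsilon=\operatorname{div}(F^\varepsilon(F^\varepsilon)^\top),\quad \partial_tF^\varepsilon+u^\varepsilon\cdot\nabla F^\varepsilon=\nabla u^\varepsilon F^\varepsilon,\quad \operatorname{div}u^\varepsilon=0,\quad (u^\varepsilon,F^\varepsilon)|_{t=0}=(u_0,F_0)$$ on $\mathbb{R}^2\times\mathbb{R}^+$ satisfying the assumptions and convergences recorded in the context. For any compact subset $\Omega\subset\mathbb{R}^2$ there exists a constant $c$ independent of $k\ge1$ such that $$\limsup_{\varepsilon\to0}\big\|T_k(|F^\varepsilon|)-T_k(\overline{|F|})\big\|_{L^3(\Omega\times[0,T])}\le c.$$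
   Context: $u^\varepsilon(x,t)\in\mathbb{R}^2$, $F^\varepsilon(x,t)\in\mathbb{R}^{2\times2}$; $|F|=\big(\sum_{i,j}F_{ij}^2\big)^{1/2}$; $(\nabla u)_{ij}=\partial_{x_j}u_i$; $\operatorname{div}F^\top$ has $j$-th component $\sum_i\partial_{x_i}F_{ij}$; $I$ is the identity matrix. $T_k(z)=kT(z/k)$, where $T(z)=z$ for $0\le z\le1$ and $T(z)=1$ for $z\ge1$. Standing assumptions on the sequence: the solutions are sufficiently smooth; $u_0\in L^2(\mathbb{R}^2)$, $F_0-I\in L^2(\mathbb{R}^2)$, $\det F_0=1$, $\operatorname{div}F_0^\top=0$, $\operatorname{div}u_0=0$; $\det F^\varepsilon=1$ and $\operatorname{div}(F^\varepsilon)^\top=0$; the energy inequality $$\tfrac12\big(\|u^\varepsilon\|_{L^2}^2+\|F^\varepsilon-I\|_{L^2}^2\big)(t)+\int_0^t\|\nabla u^\varepsilon\|_{L^2}^2ds\le\tfrac12\big(\|u_0\|_{L^2}^2+\|F_0-I\|_{L^2}^2\big)$$ holds; and, uniformly in $\varepsilon$, $F^\varepsilon$ is bounded in $L^3(B\times(0,T))$ and $P^\varepsilon$ minus its spatial average over $B$ is bounded in $L^{3/2}(B\times(0,T))$ for every ball $B\subset\mathbb{R}^2$. After extraction of a subsequence, $u^\varepsilon\to u$ weakly-* in $L^\infty(0,T;L^2(\mathbb{R}^2))\cap L^2(0,T;H^1(\mathbb{R}^2))$ and $F^\varepsilon\to F$ weakly-* in $L^\infty(0,T;L^2_{loc}(\mathbb{R}^2))$.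 $\overline{|F|}$ denotes the weak limit in $L^1$ (locally, along the subsequence) of $|F^\varepsilon|$. *)

(* Defs.v *)
From HB Require Import structures.
From mathcomp Require Export all_boot all_order all_algebra.
From mathcomp Require Export all_classical all_reals all_analysis.
Export Order.TTheory GRing.Theory Num.Theory.
Export numFieldNormedType.Exports.

Set Implicit Arguments.
Unset Strict Implicit.
Unset Printing Implicit Defensive.

Local Open Scope classical_set_scope.
Local Open Scope ring_scope.

Notation plane R := (R * R)%type.
(* A space-time point is z = (x, t). *)
Notation spacetime R := ((R * R) * R)%type.

Definition leb2 (R : realType) :=
  (@lebesgue_measure R \x @lebesgue_measure R)%E.
Definition leb3 (R : realType) :=
  (@leb2 R \x @lebesgue_measure R)%E.

Definition euclid_ball (R : realType) (a : plane R) (r : R) : set (plane R) :=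
  [set x | (x.1 - a.1) ^+ 2 + (x.2 - a.2) ^+ 2 < r ^+ 2].

Definition frob (R : realType) (m n : nat) (A : 'M[R]_(m, n)) : R :=
  Num.sqrt (\sum_i \sum_j A i j ^+ 2).

Definition LpN (d : measure_display) (X : measurableType d) (R : realType)
    (mu : {measure set X -> \bar R}) (p : R) (D : set X) (f : X -> R) : \bar R :=
  'N[mu]_(p%:E)[EFin \o (f \_ D)]%E.

Definition LpN2 (R : realType) (p : R) (D : set (plane R)) (f : plane R -> R)
  : \bar R := LpN (@leb2 R) p D f.
Definition LpN3 (R : realType) (p : R) (D : set (spacetime R))
  (f : spacetime R -> R) : \bar R := LpN (@leb3 R) p D f.

Definition L2_field (R : realType) (m n : nat) (f : plane R -> 'M[R]_(m, n)) :=
  (forall i j, measurable_fun setT (fun x => f x i j)) /\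
  (LpN2 2 setT (fun x => frob (f x)) < +oo)%E.

Section Calculus.
Variable R : realType.

Definition basis2 (j : 'I_2) : plane R := (((j == 0)%:R), ((j == 1)%:R)).

Definition pdx (j : 'I_2) (f : spacetime R -> R) (z : spacetime R) : R :=
  'D_(basis2 j, 0) f z.
Definition pdt (f : spacetime R -> R) (z : spacetime R) : R :=
  'D_((0, 0), 1) f z.

(* f is of class C^m on the open set D: the iterated directional derivatives
   up to order m exist and are continuous on D. *)
Definition Ck_on (V : normedModType R) (m : nat) (D : set V) (f : V -> R) :=
  forall s : seq V, (size s <= m)%N ->
    let g := foldr (fun v h => 'D_v h : V -> R) f s in
    (forall z, D z -> {for z, continuous g}) /\
    ((size s < m)%N -> forall z v, D z -> derivable g z v).

Definition test_fun (phi : plane R -> R) :=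
  (forall m, Ck_on m setT phi) /\
  exists2 K : set (plane R), compact K & forall x, ~ K x -> phi x = 0.

Section Fields.
Variables (m n : nat).
Implicit Type A : spacetime R -> 'M[R]_(m, n).

Definition mdt A z : 'M[R]_(m, n) :=
  \matrix_(i, j) pdt (fun y => A y i j) z.
Definition laplacian A z : 'M[R]_(m, n) :=
  \matrix_(i, j) \sum_k pdx k (pdx k (fun y => A y i j)) z.
(* (u . nabla) A *)
Definition advect (u : spacetime R -> 'cV[R]_2) A z : 'M[R]_(m, n) :=
  \matrix_(i, j) \sum_k u z k 0 * pdx k (fun y => A y i j) z.

End Fields.

Definition gradp (p : spacetime R -> R) z : 'cV[R]_2 := \col_i pdx i p z.
Definition gradv (u : spacetime R -> 'cV[R]_2) z : 'M[R]_2 :=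
  \matrix_(i, j) pdx j (fun y => u y i 0) z.
Definition divv (u : spacetime R -> 'cV[R]_2) z : R :=
  \sum_i pdx i (fun y => u y i 0) z.
(* Row-wise divergence; thus divm of F^T has j-th component
   \sum_i d_{x_i} F_ij. *)
Definition divm (M : spacetime R -> 'M[R]_2) z : 'cV[R]_2 :=
  \col_i \sum_j pdx j (fun y => M y i j) z.

(* div v = 0 in the sense of distributions on R^2 *)
Definition weak_div0 (v : plane R -> 'cV[R]_2) :=
  forall phi, test_fun phi ->
    (\int[@leb2 R]_x (\sum_i v x i 0 * 'D_(basis2 i) phi x)%:E = 0)%E.

(* G = nabla v in the sense of distributions on R^2 *)
Definition weak_grad (v : plane R -> 'cV[R]_2) (G : plane R -> 'M[R]_2) :=
  forall phi i j, test_fun phi ->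
    (\int[@leb2 R]_x (v x i 0 * 'D_(basis2 j) phi x)%:E
     = - \int[@leb2 R]_x (G x i j * phi x)%:E)%E.

Definition positive_times : set (spacetime R) := [set z | 0 < z.2].

(* u, P, F are regular enough for every derivative in the system to be
   classical and continuous for t > 0.  The data being merely L^2, they are
   attained in L^2. *)
Definition viscoelastic_solution (u0 : plane R -> 'cV[R]_2)
    (F0 : plane R -> 'M[R]_2) (u : spacetime R -> 'cV[R]_2)
    (F : spacetime R -> 'M[R]_2) (P : spacetime R -> R) :=
  [/\ [/\ forall i, Ck_on 2 positive_times (fun z => u z i 0),
          forall i j, Ck_on 1 positive_times (fun z => F z i j)
        & Ck_on 1 positive_times P],
      forall z, positive_times z ->
        [/\ mdt u z + advect u u z - laplacian u z + gradp P z
              = divm (fun y => F y *m (F y)^T) z,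
            mdt F z + advect u F z = gradv u z *m F z
          & divv u z = 0],
      forall x, u (x, 0) = u0 x /\ F (x, 0) = F0 x
    & LpN2 2 setT (fun x => frob (u (x, t) - u0 x)) @[t --> 0^'+]
        --> 0%E /\
      LpN2 2 setT (fun x => frob (F (x, t) - F0 x)) @[t --> 0^'+]
        --> 0%E].

Definition energy_inequality (u0 : plane R -> 'cV[R]_2)
    (F0 : plane R -> 'M[R]_2) (u : spacetime R -> 'cV[R]_2)
    (F : spacetime R -> 'M[R]_2) :=
  forall t : R, 0 <= t ->
  ((2^-1)%:E * (LpN2 2 setT (fun x => frob (u (x, t))) ^+ 2 +
                LpN2 2 setT (fun x => frob (F (x, t) - 1%:M)) ^+ 2) +
   \int[lebesgue_measure]_(s in `]0%R, t[)
      (LpN2 2 setT (fun x => frob (gradv u (x, s))) ^+ 2)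
   <= (2^-1)%:E * (LpN2 2 setT (fun x => frob (u0 x)) ^+ 2 +
                   LpN2 2 setT (fun x => frob (F0 x - 1%:M)) ^+ 2))%E.

Definition minus_mean (B : set (plane R)) (P : spacetime R -> R)
    (z : spacetime R) : R :=
  P z - (\int[@leb2 R]_(x in B) P (x, z.2)) / fine (@leb2 R B).

Definition slab (K : set (plane R)) (T : R) : set (spacetime R) :=
  K `*` `]0, T[.

(* A in L^oo(0,T; L^2(K)) *)
Definition LinfL2 (m n : nat) (K : set (plane R)) (T : R)
    (A : spacetime R -> 'M[R]_(m, n)) :=
  (forall i j, measurable_fun (slab K T) (fun z => A z i j)) /\
  exists C : R, {ae lebesgue_measure, forall t : R, 0 < t < T ->
    (LpN2 2 K (fun x => frob (A (x, t))) <= C%:E)%E}.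

(* phi in L^1(0,T; L^2(K)), the predual of L^oo(0,T; L^2(K)) *)
Definition L1L2 (K : set (plane R)) (T : R) (phi : spacetime R -> R) :=
  measurable_fun (slab K T) phi /\
  (\int[lebesgue_measure]_(t in `]0%R, T[)
     LpN2 2 K (fun x => phi (x, t)) < +oo)%E.

Definition L2_slab (T : R) (phi : spacetime R -> R) :=
  measurable_fun (slab setT T) phi /\
  (LpN3 2 (slab setT T) phi < +oo)%E.

Definition weakstar_LinfL2 (m n : nat) (K : set (plane R)) (T : R)
    (An : nat -> spacetime R -> 'M[R]_(m, n))
    (A : spacetime R -> 'M[R]_(m, n)) :=
  LinfL2 K T A /\
  forall phi i j, L1L2 K T phi ->
    (\int[@leb3 R]_(z in slab K T) (An k z i j * phi z)%:E)%E @[k --> \oo]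
      --> (\int[@leb3 R]_(z in slab K T) (A z i j * phi z)%:E)%E.

(* Weak convergence in L^2(0,T; H^1(R^2)); the dual of H^1 consists of the
   functionals v |-> \int v . phi + \int nabla v : psi with phi, psi in L^2. *)
Definition weak_L2H1 (T : R) (un : nat -> spacetime R -> 'cV[R]_2)
    (u : spacetime R -> 'cV[R]_2) :=
  exists Du : spacetime R -> 'M[R]_2,
  [/\ forall i, L2_slab T (fun z => u z i 0),
      forall i j, L2_slab T (fun z => Du z i j),
      {ae lebesgue_measure, forall t : R, 0 < t < T ->
         weak_grad (fun x => u (x, t)) (fun x => Du (x, t))}
    & forall (phi : spacetime R -> 'cV[R]_2) (psi : spacetime R -> 'M[R]_2),
        (forall i, L2_slab T (fun z => phi z i 0)) ->
        (forall i j, L2_slab T (fun z => psi z i j)) ->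
        (\int[@leb3 R]_(z in slab setT T)
           (\sum_i un k z i 0 * phi z i 0 +
            \sum_i \sum_j gradv (un k) z i j * psi z i j)%:E)%E @[k --> \oo]
        --> (\int[@leb3 R]_(z in slab setT T)
               (\sum_i u z i 0 * phi z i 0 +
                \sum_i \sum_j Du z i j * psi z i j)%:E)%E].

(* Weak convergence in L^1(D), tested against L^oo(D). *)
Definition weak_L1 (D : set (spacetime R)) (fn : nat -> spacetime R -> R)
    (f : spacetime R -> R) :=
  (@leb3 R).-integrable D (EFin \o f) /\
  forall phi : spacetime R -> R, measurable_fun D phi ->
    (exists C : R, forall z, D z -> `|phi z| <= C) ->
    (\int[@leb3 R]_(z in D) (fn k z * phi z)%:E)%E @[k --> \oo]
      --> (\int[@leb3 R]_(z in D) (f z * phi z)%:E)%E.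

(* T is only specified on [0, +oo[, the range of |F| and of its weak limit. *)
Definition cutoff (z : R) : R := if z <= 1 then z else 1.
Definition Tk (k z : R) : R := k * cutoff (z / k).

End Calculus.

(* Main.v *)
Require Import Defs.
From mathcomp Require Import ring lra measurable_realfun.

(** The estimate comes from the uniform L^3 bound on the F^eps, which passes to
    the weak limit.

    Since 1 <= k, the cut-off satisfies |T_k(z)| <= |z| for every real z, so
    |T_k(a) - T_k(b)|^3 <= 4 (|a|^3 + |b|^3) with a constant independent of k
    ([TkB_cube_le]).  It therefore suffices to bound |F^eps| and its weak limit
    in L^3(Omega x [0,T]).

    For |F^eps| this is the hypothesis on a ball containing Omega; the hypothesis
    concerns the open interval from 0 to T, whose end times form a null set
    ([integral_closed_slab_le]).  For the weak limit f of the f_n = |F^(e n)| it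
    is the lower semicontinuity of the L^3 norm under weak L^1 convergence
    ([weak_limit_cube_le]): with h the truncation of f at height M, the bounded
    function h |h| is an admissible test function, f h |h| >= |h|^3, and Young's
    inequality gives f_n h |h| <= f_n^3 / 3 + (2/3) |h|^3.  Letting n tend to
    infinity, the integral of |h|^3, which is finite, is absorbed on the left
    and is thus at most sup_n of the integral of f_n^3; monotone convergence
    in M concludes.

    What remains is measurability: for t > 0 the F^eps are continuous, hence
    Borel, and the Borel sets of R^2 x R lie in the product sigma-algebra because
    open sets are countable unions of cubes ([measurable_open_spacetime]); at
    t = 0 the F^eps equal the measurable datum. *)

Local Open Scope classical_set_scope.
Local Open Scope ring_scope.

Set Implicit Arguments.
Unset Strict Implicit.
Unset Printing Implicit Defensive.

(** * Pointwise inequalities *)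

(** Young's inequality for the exponents 3 and 3/2, applied to a and b^2; the
    difference of the two sides is (a - b)^2 (a + 2 b) / 3. *)
Lemma young_cube (R : realFieldType) (a b : R) : 0 <= a -> 0 <= b ->
  a * b ^+ 2 <= 3^-1 * a ^+ 3 + 2 / 3 * b ^+ 3.
Proof.
move=> a0 b0; rewrite -subr_ge0.
have -> : 3^-1 * a ^+ 3 + 2 / 3 * b ^+ 3 - a * b ^+ 2 =
  3^-1 * ((a - b) ^+ 2 * (a + 2 * b)) by rewrite !exprS expr0; field.
by rewrite mulr_ge0 ?invr_ge0// mulr_ge0 ?sqr_ge0//; lra.
Qed.

Lemma cubeD_le (R : realFieldType) (a b : R) : 0 <= a -> 0 <= b ->
  (a + b) ^+ 3 <= 4 * (a ^+ 3 + b ^+ 3).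
Proof.
move=> a0 b0; rewrite -subr_ge0.
have -> : 4 * (a ^+ 3 + b ^+ 3) - (a + b) ^+ 3 =
  3 * ((a - b) ^+ 2 * (a + b)) by rewrite !exprS expr0; ring.
by rewrite mulr_ge0// mulr_ge0 ?sqr_ge0//; lra.
Qed.

(** Negative z are included, as a weak limit is only determined up to a null
    set. *)
Lemma normr_Tk (R : realType) (k z : R) : 1 <= k -> `|Tk k z| <= `|z|.
Proof.
move=> k1; have k0 : 0 < k by exact: lt_le_trans k1.
rewrite /Tk /cutoff; case: ifPn => [_|]; first by rewrite mulrC divfK ?gt_eqF.
rewrite -ltNge ltr_pdivlMr// mul1r mulr1 => kz.
by rewrite !ger0_norm ?ltW// (lt_trans k0).
Qed.

Lemma TkB_cube_le (R : realType) (k a b : R) : 1 <= k ->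
  `|Tk k a - Tk k b| ^+ 3 <= 4 * (`|a| ^+ 3 + `|b| ^+ 3).
Proof.
move=> k1; have := cubeD_le (normr_ge0 a) (normr_ge0 b).
apply: le_trans.
rewrite lerXn2r ?nnegrE ?addr_ge0//.
by apply: le_trans (ler_normB _ _) _; rewrite lerD ?normr_Tk.
Qed.

(** * Truncation and weak lower semicontinuity of the cubic integral *)

Definition truncation (R : realType) (M x : R) : R :=
  Num.max (- M) (Num.min M x).

Lemma truncation_id (R : realType) (M x : R) : `|x| <= M -> truncation M x = x.
Proof.
by rewrite ler_norml => /andP[h1 h2]; rewrite /truncation min_r// max_r.
Qed.

Lemma norm_truncation (R : realType) (M x : R) : 0 <= M ->
  `|truncation M x| = Num.min M `|x|.
Proof.
move=> M0; rewrite /truncation; case: (leP M x) => Mx.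
  have x0 : 0 <= x by exact: le_trans Mx.
  by rewrite max_r ?(ger0_norm x0) ?(ger0_norm M0) ?min_l//; lra.
case: (leP (- M) x) => Mx'; first by rewrite min_r// ler_norml Mx' ltW.
by rewrite normrN (ger0_norm M0) ltr0_norm ?min_l//; lra.
Qed.

(** The truncation has the sign of x, so the test function h |h| turns the
    integrand of a weak limit into a nonnegative one. *)
Lemma mul_truncation (R : realType) (M x : R) : 0 <= M ->
  x * (truncation M x * `|truncation M x|) = `|x| * `|truncation M x| ^+ 2.
Proof.
move=> M0; rewrite expr2 !mulrA; congr (_ * _).
rewrite -normrM ger0_norm// /truncation.
case: (leP M x) => Mx; first by rewrite max_r ?mulr_ge0//; lra.
case: (leP (- M) x) => Mx'; first by rewrite -expr2 sqr_ge0.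
by rewrite mulr_le0//; lra.
Qed.

Lemma measurable_truncation d (X : measurableType d) (R : realType)
    (D : set X) (M : R) (f : X -> R) :
  measurable_fun D f -> measurable_fun D (fun x => truncation M (f x)).
Proof.
move=> mf; apply: measurable_maxr; first exact: measurable_cst.
by apply: measurable_minr => //; exact: measurable_cst.
Qed.

Section weak_limit.
Local Open Scope ereal_scope.

(** The smaller function may be neither nonnegative nor integrable: its positive
    part is already below g. *)
Lemma integral_le_ge0 d (X : measurableType d) (R : realType)
    (mu : {measure set X -> \bar R}) (D : set X) (f g : X -> \bar R) :
  measurable D -> measurable_fun D f -> measurable_fun D g ->
  (forall x, D x -> 0 <= g x) -> (forall x, D x -> f x <= g x) ->
  \int[mu]_(x in D) f x <= \int[mu]_(x in D) g x.
Proof.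
move=> mD mf mg g0 fg; rewrite integralE.
apply: (@le_trans _ _ (\int[mu]_(x in D) f^\+ x)).
  by rewrite -[leRHS]sube0 leeB// integral_ge0.
apply: ge0_le_integral => //; first exact: measurable_funepos.
by move=> x Dx; rewrite funeposE ge_max fg// g0.
Qed.

(** The norm is tested against its own dual element, truncated to make it
    bounded: h |h| for h the truncation of f.  Young's inequality avoids Hoelder's
    and leaves two thirds of the integral of |h|^3 to absorb, which requires that
    integral to be finite; this holds as |h|^3 <= M^2 |f|. *)
Lemma weak_limit_cube_le d (X : measurableType d) (R : realType)
    (mu : {measure set X -> \bar R}) (D : set X) (fn : nat -> X -> R)
    (f : X -> R) (C : R) :
  measurable D ->
  (forall n, measurable_fun D (fn n)) ->
  (forall n x, D x -> (0 <= fn n x)%R) ->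
  (forall n, \int[mu]_(x in D) (fn n x ^+ 3)%:E <= C%:E) ->
  mu.-integrable D (EFin \o f) ->
  (forall phi : X -> R, measurable_fun D phi ->
    (exists M : R, forall x, D x -> (`|phi x| <= M)%R) ->
    (\int[mu]_(x in D) (fn n x * phi x)%:E) @[n --> \oo]
      --> (\int[mu]_(x in D) (f x * phi x)%:E)) ->
  \int[mu]_(x in D) (`|f x| ^+ 3)%:E <= C%:E.
Proof.
move=> mD mfn fn0 fnC intf wcvg.
have mf : measurable_fun D f.
  by apply/measurable_EFinP; exact: measurable_int intf.
pose h (M : nat) x := truncation M%:R (f x).
have mh M : measurable_fun D (h M) by exact: measurable_truncation.
have mnh M : measurable_fun D (fun x => `|h M x|%R).
  exact: measurableT_comp.
have mabsf : measurable_fun D (fun x => `|(f x)%:E|).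
  by apply: measurableT_comp => //; exact/measurable_EFinP.
have mh3 M : measurable_fun D (fun x => (`|h M x| ^+ 3)%:E).
  by apply/measurable_EFinP/measurable_funX.
have hM M : \int[mu]_(x in D) (`|h M x| ^+ 3)%:E <= C%:E.
  set J := \int[mu]_(x in D) _.
  have J0 : 0 <= J by apply: integral_ge0 => x _; rewrite lee_fin exprn_ge0.
  (* absorbing 2/3 J below needs J to be finite *)
  have Jfin : J \is a fin_num.
    rewrite ge0_fin_numE//.
    apply: (@le_lt_trans _ _ (\int[mu]_(x in D) ((M%:R ^+ 2)%:E * `|(f x)%:E|))).
      apply: ge0_le_integral => //.
      - exact: measurable_funeM.
      - move=> x Dx; rewrite lee_fin exprSr ler_pM ?exprn_ge0//.
          by rewrite lerXn2r ?nnegrE// norm_truncation// ge_min lexx.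
        by rewrite norm_truncation// ge_min lexx orbT.
    rewrite ge0_integralZl ?lee_fin ?exprn_ge0//.
    apply: lte_mul_pinfty => //.
    by case/integrableP : intf.
  have JC : J <= (3^-1 * C)%:E + (2 / 3)%:E * J.
    pose phi x := (h M x * `|h M x|)%R.
    have mphi : measurable_fun D phi by exact: measurable_funM.
    have bphi : exists B : R, forall x, D x -> (`|phi x| <= B)%R.
      exists (M%:R * M%:R)%R => x _; rewrite normrM normr_id.
      by rewrite ler_pM// norm_truncation// ge_min lexx.
    apply: (@le_trans _ _ (\int[mu]_(x in D) (f x * phi x)%:E)).
      apply: ge0_le_integral => //.
      - by apply/measurable_EFinP/measurable_funM.
      - move=> x Dx; rewrite lee_fin /phi mul_truncation// exprS ler_wpM2r//.
        by rewrite norm_truncation// ge_min lexx orbT.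
    have phicvg := wcvg _ mphi bphi.
    rewrite -(cvg_lim _ phicvg)//.
    apply: lime_le; first by apply/cvg_ex; eexists; exact: phicvg.
    apply: nearW => n.
    have mfn3 : measurable_fun D (fun x => (fn n x ^+ 3)%:E).
      by apply/measurable_EFinP/measurable_funX.
    apply: (@le_trans _ _ (\int[mu]_(x in D)
      ((3^-1)%:E * (fn n x ^+ 3)%:E + (2 / 3)%:E * (`|h M x| ^+ 3)%:E))).
      apply: integral_le_ge0 => //.
      - by apply/measurable_EFinP/measurable_funM.
      - by apply: emeasurable_funD; exact: measurable_funeM.
      - move=> x Dx; rewrite -!EFinM -EFinD lee_fin.
        by rewrite addr_ge0// mulr_ge0 ?exprn_ge0 ?fn0.
      - move=> x Dx; rewrite -!EFinM -EFinD lee_fin.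
        apply: (le_trans _ (young_cube (fn0 n x Dx) (normr_ge0 (h M x)))).
        rewrite ler_wpM2l ?fn0// /phi expr2 ler_wpM2r//; exact: ler_norm.
    rewrite ge0_integralD//; last 3 first.
    - by move=> x Dx; rewrite mule_ge0// lee_fin exprn_ge0// fn0.
    - exact: measurable_funeM.
    - exact: measurable_funeM.
    rewrite !ge0_integralZl ?lee_fin//; last first.
      by move=> x Dx; rewrite lee_fin exprn_ge0// fn0.
    by rewrite (EFinM 3^-1 C) leeD2r// lee_wpmul2l ?lee_fin.
  move: JC; rewrite -(fineK Jfin) -EFinM -EFinD !lee_fin; lra.
have hcvg : \int[mu]_(x in D) (`|h M x| ^+ 3)%:E @[M --> \oo] -->
    \int[mu]_(x in D) limn (fun M => (`|h M x| ^+ 3)%:E).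
  apply: cvg_monotone_convergence => //.
  move=> x Dx m n mn; rewrite lee_fin lerXn2r ?nnegrE// !norm_truncation//.
  by rewrite le_min !ge_min ler_nat mn lexx orbT.
have -> : \int[mu]_(x in D) (`|f x| ^+ 3)%:E =
    \int[mu]_(x in D) limn (fun M => (`|h M x| ^+ 3)%:E).
  apply: eq_integral => x _; apply/esym/cvg_lim => //.
  apply: cvg_near_cst; near=> M.
  rewrite /h truncation_id//; near: M; exact: nbhs_infty_ger.
rewrite -(cvg_lim _ hcvg)//; apply: lime_le.
  by apply/cvg_ex; eexists; exact: hcvg.
exact: nearW.
Unshelve. all: by end_near. Qed.

End weak_limit.

(** * Borel sets of space-time *)

Definition rational_cube (R : realType) (i : (rat * rat * rat) * nat) :
    set (spacetime R) :=
  (ball (ratr i.1.1.1 : R) i.2.+1%:R^-1 `*` ball (ratr i.1.1.2 : R) i.2.+1%:R^-1)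
  `*` ball (ratr i.1.2 : R) i.2.+1%:R^-1.

Lemma ratr_near (R : realType) (x e : R) : 0 < e ->
  exists q : rat, ball (ratr q : R) e x.
Proof.
move=> e0; have [|q] := @rat_in_itvoo R (x - e) (x + e); first lra.
rewrite in_itv/= => /andP[h1 h2]; exists q.
by rewrite /ball/= ltr_distlC; apply/andP; split; lra.
Qed.

(** The product sigma-algebra of a second countable product contains its open
    sets. *)
Lemma measurable_open_spacetime (R : realType) (U : set (spacetime R)) :
  open U -> measurable U.
Proof.
move=> oU.
have -> : U = \bigcup_(i in [set i | @rational_cube R i `<=` U]) @rational_cube R i.
  apply/seteqP; split=> [z Uz|z [i iU iz]]; last exact: iU.
  have /nbhs_ballP[e /= e0 zeU] : nbhs z U by exact: open_nbhs_nbhs.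
  (* a cube of half-width 1/(n+1) around a point within 1/(n+1) of z stays within
     2/(n+1) < e of z *)
  pose n := Num.truncn (2 / e).
  have n0 : 0 < n.+1%:R^-1 :> R by rewrite invr_gt0.
  have ne : n.+1%:R^-1 + n.+1%:R^-1 < e.
    have : 2 / e < n.+1%:R by exact: truncnS_gt.
    rewrite ltr_pdivrMr// mulrC -ltr_pdivrMr// => h.
    by rewrite -mulr2n -(mulr_natl _ 2).
  have [a za] := ratr_near z.1.1 n0.
  have [b zb] := ratr_near z.1.2 n0.
  have [c zc] := ratr_near z.2 n0.
  exists (a, b, c, n) => // y [[ya yb] yc]; apply: zeU.
  by split; first split; apply: le_ball (ltW ne) _ _;
    [exact: ball_triangle (ball_sym za) ya|exact: ball_triangle (ball_sym zb) yb
    |exact: ball_triangle (ball_sym zc) yc].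
rewrite bigcup_mkcond; apply: countable_bigcupT_measurable => [//|i].
case: ifPn => // _.
by apply: measurableX; first apply: measurableX; exact: measurable_ball.
Qed.

(** The complement is the section at time 0 of an open cylinder of
    space-time. *)
Lemma measurable_compact_plane (R : realType) (K : set (plane R)) :
  compact K -> measurable K.
Proof.
move=> cK; have cl : closed K by apply: compact_closed.
rewrite -[K]setCK; apply: measurableC.
have -> : ~` K = (fun x => (x, 0 : R)) @^-1` (fst @^-1` (~` K)) by [].
rewrite -[X in measurable X]setTI; apply: pair2_measurable => //.
apply: measurable_open_spacetime; apply: open_comp => //.
  by move=> z _; exact: cvg_fst.
exact: closed_openC.
Qed.

Lemma measurable_continuous_on_open (R : realType) (D : set (spacetime R))
    (f : spacetime R -> R) : open D ->
  (forall z, D z -> {for z, continuous f}) -> measurable_fun D f.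
Proof.
move=> oD cf mD; apply: (measurability _ (RGenOpens.measurableE R)) => //.
move=> _ [_ [a [b ->] <-]]; apply: measurable_open_spacetime.
rewrite openE => z [Dz fz].
apply: filterI; first exact: open_nbhs_nbhs.
apply: cf => //; apply: open_nbhs_nbhs; split => //; exact: interval_open.
Qed.

(** * The cubic norm and the cut-off *)

Lemma LpN_cubeE d (X : measurableType d) (R : realType)
    (mu : {measure set X -> \bar R}) (D : set X) (f : X -> R) :
  (LpN mu 3 D f `^ 3 = \int[mu]_(x in D) (`|f x| ^+ 3)%:E)%E.
Proof.
rewrite /LpN poweR_Lnorm// [RHS]integral_mkcond; apply: eq_integral => x _.
rewrite /= /patch; case: ifPn => _ //=; last by rewrite normr0 powR0.
by rewrite (powR_mulrn 3).
Qed.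

Lemma cube_integral_le d (X : measurableType d) (R : realType)
    (mu : {measure set X -> \bar R}) (D : set X) (f : X -> R) (C : R) :
  (LpN mu 3 D f <= C%:E ->
  \int[mu]_(x in D) (`|f x| ^+ 3)%:E <= (C ^+ 3)%:E)%E.
Proof.
move=> fC; have N0 : (0 <= LpN mu 3 D f)%E by exact: Lnorm_ge0.
have C0 : 0 <= C by rewrite -lee_fin (le_trans N0).
rewrite -LpN_cubeE -(powR_mulrn 3)// -poweR_EFin.
by rewrite gt0_ler_poweR// in_itv/= ?N0 ?lee_fin ?C0 leey.
Qed.

Lemma LpN_cube_le d (X : measurableType d) (R : realType)
    (mu : {measure set X -> \bar R}) (D : set X) (f : X -> R) (C : R) :
  (\int[mu]_(x in D) (`|f x| ^+ 3)%:E <= C%:E ->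
  LpN mu 3 D f <= (C `^ 3^-1)%:E)%E.
Proof.
rewrite -LpN_cubeE => fC; have N0 : (0 <= LpN mu 3 D f)%E by exact: Lnorm_ge0.
have C0 : 0 <= C by rewrite -lee_fin (le_trans _ fC)// poweR_ge0.
have -> : LpN mu 3 D f = ((LpN mu 3 D f `^ 3) `^ 3^-1)%E.
  by rewrite -poweRrM mulfV// poweRe1.
rewrite -poweR_EFin.
by rewrite gt0_ler_poweR// in_itv/= ?poweR_ge0 ?lee_fin ?C0 leey.
Qed.

Lemma measurable_Tk d (X : measurableType d) (R : realType) (D : set X)
    (k : R) (f : X -> R) :
  measurable_fun D f -> measurable_fun D (fun x => Tk k (f x)).
Proof.
move=> mf; have TkE x : Tk k (f x) = k * Num.min (f x * k^-1) 1.
  by rewrite /Tk /cutoff; case: leP.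
under eq_fun do rewrite TkE.
apply: measurable_funM => //; apply: measurable_minr => //.
exact: measurable_funM.
Qed.

Lemma LpN_TkB_le d (X : measurableType d) (R : realType)
    (mu : {measure set X -> \bar R}) (D : set X) (f g : X -> R) (C k : R) :
  measurable D -> measurable_fun D f -> measurable_fun D g -> 1 <= k ->
  (\int[mu]_(x in D) (`|f x| ^+ 3)%:E <= C%:E ->
   \int[mu]_(x in D) (`|g x| ^+ 3)%:E <= C%:E ->
   LpN mu 3 D (fun x => (Tk k (f x) - Tk k (g x))%R)
     <= ((4 * (C + C)) `^ 3^-1)%:E)%E.
Proof.
move=> mD mf mg k1 fC gC; apply: LpN_cube_le.
have mcube (h : X -> R) : measurable_fun D h ->
    measurable_fun D (fun x => (`|h x| ^+ 3)%:E).
  by move=> mh; apply/measurable_EFinP/measurable_funX; exact: measurableT_comp.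
have msum := emeasurable_funD (mcube f mf) (mcube g mg).
apply: (@le_trans _ _ (\int[mu]_(x in D)
    (4%:E * ((`|f x| ^+ 3)%:E + (`|g x| ^+ 3)%:E)))%E).
  apply: ge0_le_integral => //.
  - by apply: mcube; apply: measurable_funB; exact: measurable_Tk.
  - exact: measurable_funeM.
  - by move=> x _; rewrite -EFinD -EFinM lee_fin TkB_cube_le.
rewrite ge0_integralZl//.
rewrite ge0_integralD//; [|exact: mcube|exact: mcube].
  by rewrite EFinM lee_wpmul2l ?lee_fin// EFinD leeD.
by move=> x _; rewrite -EFinD lee_fin addr_ge0 ?exprn_ge0.
Qed.

Lemma limn_esup_le (R : realType) (v : nat -> \bar R) (l : \bar R) :
  (forall n, (v n <= l)%E) -> (limn_esup v <= l)%E.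
Proof.
move=> vl; rewrite limn_esup_lim; apply: lime_le; first exact: is_cvg_esups.
by apply: nearW => n; apply: ge_ereal_sup => _ [m _ <-].
Qed.

(** * Fields on closed slabs *)

Lemma measurable_frob d (X : measurableType d) (R : realType) (m n : nat)
    (D : set X) (A : X -> 'M[R]_(m, n)) :
  (forall i j, measurable_fun D (fun x => A x i j)) ->
  measurable_fun D (fun x => frob (A x)).
Proof.
move=> mA; have frobE x :
    frob (A x) = (\sum_i \sum_j A x i j ^+ 2) `^ 2^-1.
  by rewrite powR12_sqrt// !sumr_ge0// => i _; rewrite sumr_ge0// => j _;
    rewrite sqr_ge0.
under eq_fun do rewrite frobE.
apply: (measurableT_comp (measurable_powR _)).
apply: measurable_sum => i; apply: measurable_sum => j.
exact: measurable_funX.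
Qed.

Lemma compact_sub_euclid_ball (R : realType) (K : set (plane R)) :
  compact K -> exists2 r : R, 0 < r & K `<=` euclid_ball (0, 0) r.
Proof.
move=> /compact_bounded[M [_ KM]].
pose a := `|M| + 1; have a0 : 0 < a by rewrite ltr_wpDl.
have Ma : M < a by rewrite (le_lt_trans (ler_norm _))// ltrDl.
(* the factor 2 exceeds the square root of 2 relating the two norms *)
exists (2 * a); first by rewrite mulr_gt0.
move=> x /(KM _ Ma) /= xa; move: (xa).
rewrite [leLHS]prod_normE ge_max => /andP[x1 x2].
rewrite /euclid_ball/= !subr0.
have sq y : `|y| <= a -> y ^+ 2 <= a ^+ 2.
  by move=> ya; rewrite -real_normK ?num_real// lerXn2r ?nnegrE// ltW.
have := sq _ x1; have := sq _ x2; have : 0 < a ^+ 2 by rewrite exprn_gt0.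
rewrite exprMn; lra.
Qed.

Lemma measurable_euclid_ball (R : realType) (a : plane R) (r : R) :
  measurable (euclid_ball a r).
Proof.
rewrite -[X in measurable X]setTI.
have mfun : measurable_fun [set: plane R]
    (fun x => (x.1 - a.1) ^+ 2 + (x.2 - a.2) ^+ 2).
  by apply: measurable_funD; apply: measurable_funX; apply: measurable_funB.
have := mfun measurableT `]-oo, r ^+ 2[%classic (measurable_itv _).
by congr measurable; apply/seteqP; split=> x /=; rewrite in_itv.
Qed.

(** Regularity is only available for t > 0; the initial time contributes the
    slice on which f is the datum f0. *)
Lemma measurable_with_trace (R : realType) (f : spacetime R -> R)
    (f0 : plane R -> R) :
  Ck_on 1 (@positive_times R) f -> (forall x, f (x, 0) = f0 x) ->
  measurable_fun setT f0 ->
  measurable_fun [set z : spacetime R | 0 <= z.2] f.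
Proof.
move=> Cf ff0 mf0.
have oP : open (@positive_times R).
  have -> : @positive_times R = snd @^-1` [set t : R | 0 < t] by [].
  apply: open_comp; last exact: open_gt.
  by move=> z _; exact: cvg_snd.
have mP := measurable_open_spacetime oP.
have mZ : measurable ([set: plane R] `*` [set (0 : R)]) by exact: measurableX.
have -> : [set z : spacetime R | 0 <= z.2] =
    @positive_times R `|` [set: plane R] `*` [set 0].
  apply/seteqP; split=> [z|z [/ltW//|[_ /= ->]]]; last by rewrite /= lexx.
  by rewrite /= le_eqVlt => /predU1P[z0|]; [right; split|left].
apply/measurable_funU => //; split.
  have [cf _] := Cf [::] isT; exact: measurable_continuous_on_open.
apply: (eq_measurable_fun (f0 \o fst)).
  by move=> [x t]; rewrite inE /= => -[_ /= ->]; rewrite ff0.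
apply: (measurableT_comp mf0); apply: measurable_funTS; exact: measurable_fst.
Qed.

Lemma measurable_half_space (R : realType) :
  measurable [set z : spacetime R | 0 <= z.2].
Proof.
rewrite -[X in measurable X]setTI.
have := @measurable_snd _ _ (plane R) R measurableT _ (measurable_itv `[0, +oo[).
by congr measurable; apply/seteqP; split=> x /=; rewrite in_itv/= andbT.
Qed.

Lemma ge0_integral_le_off_null d (X : measurableType d) (R : realType)
    (mu : {measure set X -> \bar R}) (D E N : set X) (f : X -> \bar R) :
  measurable D -> measurable E -> measurable N ->
  mu N = 0%E -> D `\` N `<=` E ->
  measurable_fun D f -> measurable_fun E f -> (forall x, 0 <= f x)%E ->
  (\int[mu]_(x in D) f x <= \int[mu]_(x in E) f x)%E.
Proof.
move=> mD mE mN N0 DE mfD mfE f0.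
rewrite (@ge0_negligible_integral _ _ _ mu _ N)//.
by apply: ge0_subset_integral => //; exact: measurableD.
Qed.

(** The end times t = 0 and t = T form a null set, so nothing is lost by passing
    to the open slab. *)
Lemma integral_closed_slab_le (R : realType) (T : R) (K B : set (plane R))
    (f : spacetime R -> \bar R) :
  measurable K -> measurable B -> K `<=` B ->
  measurable_fun [set z : spacetime R | 0 <= z.2] f ->
  (forall z, 0 <= f z)%E ->
  (\int[@leb3 R]_(z in K `*` `[0%R, T]) f z
     <= \int[@leb3 R]_(z in slab B T) f z)%E.
Proof.
move=> mK mB KB mf f0.
pose N : set (spacetime R) := [set: plane R] `*` [set 0; T].
have mT : measurable [set 0; T] by exact: measurableU.
have mN : measurable N by exact: measurableX.
have m0 := @measurable_half_space R.
have N0 : (leb3 N = 0)%E.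
  have T0 : (lebesgue_measure [set 0%R; T] = 0)%E.
    by apply: countable_lebesgue_measure0; exact/finite_set_countable/finite_set2.
  have -> : leb3 N = (@leb2 R setT * lebesgue_measure [set 0%R; T])%E.
    exact: product_measure1E.
  by rewrite T0 mule0.
have mD : measurable (K `*` `[0%R, T]) by exact: measurableX.
have mfD : measurable_fun (K `*` `[0%R, T]) f.
  by apply: measurable_funS mf => // z [_] /=; rewrite in_itv/= => /andP[].
have mfB : measurable_fun (slab B T) f.
  by apply: measurable_funS mf => // z [_] /=; rewrite in_itv/= => /andP[/ltW].
have mslab : measurable (slab B T) by exact: measurableX.
apply: (@ge0_integral_le_off_null _ _ R (@leb3 R) _ _ _ _ mD mslab mN N0) => //.
move=> z [[Kz]] /=; rewrite !in_itv/= => /andP[z0 zT] Nz.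
split; first exact: KB.
rewrite /= in_itv/= !lt_neqAle z0 zT !andbT; apply/andP; split; apply/eqP => h.
  by apply: Nz; split=> //; left.
by apply: Nz; split=> //; right.
Qed.

(** * The uniform bound *)

Theorem lemma3p2 (R : realType) (T : R) (hT : 0 < T)
  (u0 : plane R -> 'cV[R]_2) (F0 : plane R -> 'M[R]_2)
  (hu0 : L2_field u0)
  (hF0 : L2_field (fun x => F0 x - 1%:M))
  (hdetF0 : {ae @leb2 R, forall x, \det (F0 x) = 1})
  (hdivF0 : forall j : 'I_2, weak_div0 (fun x => col j (F0 x)))
  (hdivu0 : weak_div0 u0)
  (* the family indexed by eps > 0 *)
  (u : R -> spacetime R -> 'cV[R]_2)
  (F : R -> spacetime R -> 'M[R]_2)
  (P : R -> spacetime R -> R)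
  (hsol : forall eps : R, 0 < eps ->
    viscoelastic_solution u0 F0 (u eps) (F eps) (P eps))
  (hdetF : forall eps : R, 0 < eps -> forall z, positive_times z ->
    \det (F eps z) = 1)
  (hdivF : forall eps : R, 0 < eps -> forall z, positive_times z ->
    divm (fun y => (F eps y)^T) z = 0)
  (henergy : forall eps : R, 0 < eps ->
    energy_inequality u0 F0 (u eps) (F eps))
  (hFL3 : forall (a : plane R) (r : R), 0 < r ->
    exists C : R, forall eps : R, 0 < eps ->
      (LpN3 3 (slab (euclid_ball a r) T)
         (fun z => frob (F eps z)) <= C%:E)%E)
  (hPL32 : forall (a : plane R) (r : R), 0 < r ->
    exists C : R, forall eps : R, 0 < eps ->
      (LpN3 (3 / 2) (slab (euclid_ball a r) T)
         (minus_mean (euclid_ball a r) (P eps)) <= C%:E)%E)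
  (* the extracted subsequence and its limits *)
  (e : nat -> R) (he0 : forall n, 0 < e n) (he : e n @[n --> \oo] --> 0)
  (ul : spacetime R -> 'cV[R]_2) (Fl : spacetime R -> 'M[R]_2)
  (absF : spacetime R -> R)
  (hul : weakstar_LinfL2 setT T (fun n => u (e n)) ul)
  (hulH1 : weak_L2H1 T (fun n => u (e n)) ul)
  (hFl : forall K : set (plane R), compact K ->
    weakstar_LinfL2 K T (fun n => F (e n)) Fl)
  (habsF : forall K : set (plane R), compact K ->
    weak_L1 (K `*` `[0, T]) (fun n z => frob (F (e n) z)) absF) :
  forall Omega : set (plane R), compact Omega ->
    exists c : R, forall k : R, 1 <= k ->
      (limn_esup (fun n => LpN3 3 (Omega `*` `[0%R, T])
         (fun z => (Tk k (frob (F (e n) z)) - Tk k (absF z))%R)) <= c%:E)%E.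
Proof.
move=> Omega cO.
(* hFL3 speaks of balls, so Omega is enlarged to one *)
have [r r0 Or] := compact_sub_euclid_ball cO.
have [C FC] := hFL3 (0, 0) r r0.
have mO := measurable_compact_plane cO.
have mD : measurable (Omega `*` `[0%R, T]) by exact: measurableX.
have mF n : measurable_fun [set z : spacetime R | 0 <= z.2]
    (fun z => frob (F (e n) z)).
  apply: measurable_frob => i j.
  have [[_ CF _] _ F_0 _] := hsol _ (he0 n).
  apply: (@measurable_with_trace _ _ (fun x => F0 x i j)) => //.
    by move=> x; rewrite (F_0 x).2.
  (* only F0 - I is assumed measurable *)
  have := hF0.1 i j; have -> : (fun x => F0 x i j) =
    (fun x => (F0 x - 1%:M) i j + (1%:M : 'M[R]_2) i j).
    by apply/funext => x; rewrite !mxE subrK.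
  by move=> mF0; exact: measurable_funD.
have mFD n : measurable_fun (Omega `*` `[0%R, T])
    (fun z => frob (F (e n) z)).
  apply: measurable_funS (mF n); first exact: measurable_half_space.
  by move=> z [_]; rewrite /= in_itv/= => /andP[].
have F3 n : (\int[@leb3 R]_(z in Omega `*` `[0%R, T])
    (`|frob (F (e n) z)| ^+ 3)%:E <= (C ^+ 3)%:E)%E.
  apply: le_trans (cube_integral_le (FC _ (he0 n))).
  apply: integral_closed_slab_le => //; first exact: measurable_euclid_ball.
  by apply/measurable_EFinP/measurable_funX; exact: measurableT_comp.
have [intF wF] := habsF _ cO.
have absF3 : (\int[@leb3 R]_(z in Omega `*` `[0%R, T])
    (`|absF z| ^+ 3)%:E <= (C ^+ 3)%:E)%E.
  apply: (@weak_limit_cube_le _ _ R (@leb3 R) _ _ _ _ mD mFD) => // [n z _|n].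
    exact: sqrtr_ge0.
  apply: le_trans (F3 n); under [leRHS]eq_integral => z _.
    by rewrite ger0_norm ?sqrtr_ge0//; over.
  by [].
have mabsF : measurable_fun (Omega `*` `[0%R, T]) absF.
  by have /measurable_EFinP := measurable_int (@leb3 R) intF.
exists ((4 * (C ^+ 3 + C ^+ 3)) `^ 3^-1) => k k1; apply: limn_esup_le => n.
exact: (@LpN_TkB_le _ _ R (@leb3 R) _ _ _ _ _ mD (mFD n) mabsF k1 (F3 n) absF3).
Qed.
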